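(* Any tester for determining whether a bipartite pure state in $\mathbb{C}^d\otimes\mathbb{C}^d$ is maximally entangled or $\varepsilon$-far from every maximally entangled state (in trace distance) requires sample complexity $\mathsf{S}(\textsc{MaximalEntanglement}_\varepsilon)=\Omega(d/\varepsilon^2)$.
   Context: $\textsc{MaximalEntanglement}$ is the set of unit vectors $|\psi\rangle\in\mathbb{C}^d\otimes\mathbb{C}^d$ with $\mathrm{tr}_B|\psi\rangle\langle\psi|=I/d$. For a set $\mathcal{Q}$ of pure states, $\mathcal{Q}_\varepsilon$ has yes-set $\mathcal{Q}$ and no-set the pure states at trace distance $\ge\varepsilon$ from all of $\mathcal{Q}$ (trace distance of pure states $\sqrt{1-|\langle\psi|\phi\rangle|^2}$). $\mathsf{S}(\cdot)$ is the minimum $N$ such that some operator $0\preceq\mathcal{T}\preceq I$ on $N$ copies accepts yes-instances with probability $\ge2/3$ and no-instances with probability $\le1/3$. *)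

(* Defs.v *)
From HB Require Import structures.
From mathcomp Require Import all_boot all_order all_algebra.
From mathcomp Require Import complex.
From mathcomp Require Import reals.
Set Implicit Arguments. Unset Strict Implicit. Unset Printing Implicit Defensive.
Import Order.TTheory GRing.Theory Num.Theory.
Local Open Scope ring_scope.

Section QDefs.
Variable R : realType.
Local Notation C := (R[i]).

Definition vec (I : finType) := I -> C.
Definition oper (I : finType) := I -> I -> C.

Definition inner (I : finType) (u v : vec I) : C := \sum_(x : I) (u x)^* * v x.

Definition unit_vec (I : finType) (u : vec I) : Prop := inner u u = 1.

Definition sandwich (I : finType) (u : vec I) (A : oper I) (v : vec I) : C :=
  \sum_(x : I) \sum_(y : I) (u x)^* * A x y * v y.

(* A is positive semidefinite: <v|A|v> >= 0 for every v (this forces real values). *)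
Definition psd (I : finType) (A : oper I) : Prop := forall v : vec I, 0 <= sandwich v A v.

Definition idop (I : finType) : oper I := fun x y => (x == y)%:R.

Definition povm_elem (I : finType) (T : oper I) : Prop :=
  psd T /\ psd (fun x y => idop x y - T x y).

Definition bip (d : nat) := ('I_d * 'I_d)%type.

Definition ptraceB (d : nat) (psi : vec (bip d)) : 'I_d -> 'I_d -> C :=
  fun i i' => \sum_(j < d) psi (i, j) * (psi (i', j))^*.

Definition max_ent (d : nat) (psi : vec (bip d)) : Prop :=
  unit_vec psi /\ forall i i' : 'I_d, ptraceB psi i i' = (i == i')%:R / d%:R.

(* Trace distance of pure states: sqrt(1 - |<psi|phi>|^2). *)
Definition tdist (I : finType) (psi phi : vec I) : C :=
  sqrtC (1 - `|inner psi phi| ^+ 2).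

Definition copies (N : nat) (I : finType) := {ffun 'I_N -> I}.
Definition tpow (N : nat) (I : finType) (psi : vec I) : vec (copies N I) :=
  fun f => \prod_(k < N) psi (f k).

Definition yes_inst (I : finType) (Q : vec I -> Prop) (psi : vec I) := Q psi.
Definition no_inst (I : finType) (Q : vec I -> Prop) (eps : R) (phi : vec I) :=
  unit_vec phi /\ forall psi, Q psi -> real_complex R eps <= tdist psi phi.

Definition tester (I : finType) (Q : vec I -> Prop) (eps : R) (N : nat)
    (T : oper (copies N I)) : Prop :=
  povm_elem T /\
  (forall psi, yes_inst Q psi -> real_complex R (2%:R / 3%:R) <= sandwich (@tpow N _ psi) T (@tpow N _ psi)) /\
  (forall phi, no_inst Q eps phi -> sandwich (@tpow N _ phi) T (@tpow N _ phi) <= real_complex R (1 / 3%:R)).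

(* N copies suffice: S(Q_eps) is the minimum such N. *)
Definition testable_with (I : finType) (Q : vec I -> Prop) (eps : R) (N : nat) : Prop :=
  exists T : oper (copies N I), @tester I Q eps N T.

End QDefs.

(* Main.v *)
Require Import Defs.
From HB Require Import structures.
From mathcomp Require Import all_boot all_order all_algebra all_fingroup.
From mathcomp Require Import cyclic separable cyclotomic.
From mathcomp Require Import complex reals ring lra zify.
Import Order.TTheory GRing.Theory Num.Theory.
Set Implicit Arguments.
Unset Strict Implicit.
Unset Printing Implicit Defensive.
Local Open Scope ring_scope.

(** The hard instances are rho_s^(1/2) = a P_s + b (1 - P_s), where s ranges over
    the permutations of m = d/2 points, P_s projects onto the span of the vectors
    e_i + e_(m + s i), and a, b are 1 + O(eps).  The states rho_s / d have pairwise
    overlap governed by the number of fixed points of s^-1 t, which behaves like a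
    Poisson(1) variable, so that the second moment
    E_(s,t) (tr(rho_s rho_t) / d)^N - 1 stays below 4/27 unless N = Omega(d / eps^2).

    A tester sees the purification M of M M^* rather than M M^* itself.  If it
    were invariant under the unitaries of the second factor, dephasing with respect
    to P_s would give <M|T|M> = <1|T|M M^*> for M = rho_s^(1/2).  Hence the
    acceptance probabilities would be T-inner products with the single vector |1>,
    and positivity of T and of 1 - T would bound their average gap by the second
    moment.  A tester of almost minimal Hilbert-Schmidt norm is almost invariant,
    which is enough. *)

(** * Operators and testers *)

Section Operators.
Variable R : realType.
Local Notation C := (R[i]).

Section OneSystem.
Variable I : finType.
Implicit Types (A B T W : oper R I) (u v : vec R I).

Definition apply_op A v : vec R I := fun x => \sum_y A x y * v y.
Definition comp_op A B : oper R I := fun x y => \sum_z A x z * B z y.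
Definition adj_op A : oper R I := fun x y => (A y x)^*.
Definition pull_op W T : oper R I := comp_op (adj_op W) (comp_op T W).
Definition hs_norm2 A : C := \sum_x \sum_y `|A x y| ^+ 2.

Definition unitary_op W : Prop :=
  comp_op (adj_op W) W =2 @idop R I /\ comp_op W (adj_op W) =2 @idop R I.

Lemma eq_inner u v u' v' : u =1 u' -> v =1 v' -> inner u v = inner u' v'.
Proof. by move=> eu ev; apply: eq_bigr => x _; rewrite eu ev. Qed.

Lemma eq_sandwich u v u' v' T :
  u =1 u' -> v =1 v' -> sandwich u T v = sandwich u' T v'.
Proof.
by move=> eu ev; apply: eq_bigr => x _; apply: eq_bigr => y _; rewrite eu ev.
Qed.

Lemma sandwichE u T v : sandwich u T v = inner u (apply_op T v).
Proof.
apply: eq_bigr => x _; rewrite mulr_sumr; apply: eq_bigr => y _.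
by rewrite mulrA.
Qed.

Lemma apply_comp A B v : apply_op (comp_op A B) v =1 apply_op A (apply_op B v).
Proof.
move=> x; rewrite /apply_op /comp_op.
under eq_bigr do rewrite mulr_suml.
rewrite exchange_big; apply: eq_bigr => z _ /=.
by rewrite mulr_sumr; apply: eq_bigr => y _; rewrite mulrA.
Qed.

Lemma inner_adj A u v : inner u (apply_op (adj_op A) v) = inner (apply_op A u) v.
Proof.
rewrite /inner /apply_op /adj_op.
under eq_bigr do rewrite mulr_sumr.
rewrite exchange_big; apply: eq_bigr => z _ /=.
rewrite rmorph_sum mulr_suml; apply: eq_bigr => y _.
by rewrite rmorphM /= mulrA [_^* * _]mulrC.
Qed.

Lemma apply_id v : apply_op (@idop R I) v =1 v.
Proof.
move=> x; rewrite /apply_op (bigD1 x) //= /idop eqxx mul1r big1 ?addr0 //.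
by move=> y /negbTE; rewrite eq_sym => ->; rewrite mul0r.
Qed.

Lemma eq_apply A B u v : A =2 B -> u =1 v -> apply_op A u =1 apply_op B v.
Proof. by move=> eA euv x; apply: eq_bigr => y _; rewrite eA euv. Qed.

Lemma inner_unitary W u v :
  unitary_op W -> inner (apply_op W u) (apply_op W v) = inner u v.
Proof.
case=> WW _; rewrite -inner_adj; apply: eq_inner => // x.
by rewrite -apply_comp (eq_apply WW (frefl _)) apply_id.
Qed.

Lemma sandwich_pull u W T v :
  sandwich u (pull_op W T) v = sandwich (apply_op W u) T (apply_op W v).
Proof.
rewrite !sandwichE -inner_adj; apply: eq_inner => // x.
rewrite apply_comp; apply: eq_apply => // y.
exact: apply_comp.
Qed.

Lemma sandwich_lin u T T' v (a b : C) :
  sandwich u (fun x y => a * T x y + b * T' x y) v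
    = a * sandwich u T v + b * sandwich u T' v.
Proof.
rewrite /sandwich !mulr_sumr -big_split; apply: eq_bigr => x _ /=.
rewrite !mulr_sumr -big_split; apply: eq_bigr => y _ /=; ring.
Qed.

Lemma sandwich_idB v T :
  sandwich v (fun x y => idop R x y - T x y) v = inner v v - sandwich v T v.
Proof.
rewrite -[inner v v](eq_inner (frefl v) (apply_id v)) -sandwichE.
rewrite /sandwich -sumrB; apply: eq_bigr => x _.
by rewrite -sumrB; apply: eq_bigr => y _; rewrite mulrBr mulrBl.
Qed.

Lemma povm_pull W T : unitary_op W -> povm_elem T -> povm_elem (pull_op W T).
Proof.
move=> uW [T0 T1]; split=> v; first by rewrite sandwich_pull; apply: T0.
by rewrite sandwich_idB sandwich_pull -(inner_unitary _ _ uW) -sandwich_idB.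
Qed.

Lemma povm_mid T T' : povm_elem T -> povm_elem T' ->
  povm_elem (fun x y => 2^-1 * T x y + 2^-1 * T' x y).
Proof.
move=> [T0 T1] [T0' T1']; have h0 : 0 <= 2^-1 :> C by rewrite invr_ge0 ler0n.
split=> v; first by rewrite sandwich_lin addr_ge0 ?mulr_ge0.
rewrite sandwich_idB sandwich_lin.
move: (mulr_ge0 h0 (T1 v)) (mulr_ge0 h0 (T1' v)); rewrite !sandwich_idB.
move=> a b; apply: (le_trans (addr_ge0 a b)); rewrite le_eqVlt; apply/orP; left.
by apply/eqP; field.
Qed.

Lemma hs_norm2_adj A : hs_norm2 (adj_op A) = hs_norm2 A.
Proof.
rewrite [LHS]exchange_big; apply: eq_bigr => x _; apply: eq_bigr => y _.
by rewrite norm_conjC.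
Qed.

Lemma hs_norm2_comp A W : unitary_op W -> hs_norm2 (comp_op A W) = hs_norm2 A.
Proof.
case=> _ WW; apply: eq_bigr => x _.
transitivity (\sum_y \sum_z A x y * (A x z)^* * idop R y z).
  under [RHS]eq_bigr do under eq_bigr do rewrite -WW mulr_sumr.
  under [RHS]eq_bigr do rewrite exchange_big /=.
  rewrite exchange_big; apply: eq_bigr => w _ /=.
  rewrite normCK {1}/comp_op mulr_suml; apply: eq_bigr => y _.
  rewrite rmorph_sum mulr_sumr; apply: eq_bigr => z _.
  by rewrite rmorphM /adj_op /=; ring.
apply: eq_bigr => y _; rewrite (bigD1 y) //= /idop eqxx mulr1 normCK big1 ?addr0 //.
by move=> z /negbTE; rewrite eq_sym => ->; rewrite mulr0.
Qed.

(** [hs_norm2_comp] handles the right factor; passing to adjoints turns the left factor W^* into a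
    right factor W. *)
Lemma hs_norm2_pull W T : unitary_op W -> hs_norm2 (pull_op W T) = hs_norm2 T.
Proof.
move=> uW; rewrite -(hs_norm2_comp T uW) -[RHS]hs_norm2_adj -[RHS](hs_norm2_comp _ uW).
rewrite -[LHS]hs_norm2_adj; apply: eq_bigr => x _; apply: eq_bigr => y _.
congr (`|_| ^+ 2); rewrite {1}/adj_op /pull_op {1}/comp_op rmorph_sum.
by apply: eq_bigr => z _; rewrite rmorphM /= conjCK mulrC.
Qed.

Lemma hs_norm2_ge0 A : 0 <= hs_norm2 A.
Proof. by apply: sumr_ge0 => x _; apply: sumr_ge0 => y _; apply: exprn_ge0. Qed.

Lemma entry_le_hs_norm2 A x y : `|A x y| ^+ 2 <= hs_norm2 A.
Proof.
rewrite /hs_norm2 (bigD1 x) //= (bigD1 y) //= -addrA lerDl addr_ge0 //.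
  by apply: sumr_ge0 => ? _; apply: exprn_ge0.
by apply: sumr_ge0 => ? _; apply: sumr_ge0 => ? _; apply: exprn_ge0.
Qed.

(** Arranged around the midpoint: when it is not much shorter than [A] and [B], these two are
    close. *)
Lemma parallelogram_hs A B :
  hs_norm2 (fun x y => A x y - B x y) =
    2 * hs_norm2 A + 2 * hs_norm2 B
      - 4 * hs_norm2 (fun x y => 2^-1 * A x y + 2^-1 * B x y).
Proof.
rewrite /hs_norm2 !mulr_sumr -big_split -sumrB; apply: eq_bigr => x _ /=.
rewrite !mulr_sumr -big_split -sumrB; apply: eq_bigr => y _ /=.
rewrite -mulrDr !normCK !(rmorphB, rmorphD, rmorphM) /= fmorphV rmorph_nat.
by field.
Qed.

End OneSystem.

(** * Tensor powers of operators and vectors *)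

Section TensorPowers.
Variables (I : finType) (N : nat).
Implicit Types (A B T W : oper R I) (u v : vec R I).

Definition tens_op A : oper R (copies N I) := fun f g => \prod_(k < N) A (f k) (g k).

Lemma apply_tens A v : apply_op (tens_op A) (@tpow R N I v) =1 @tpow R N I (apply_op A v).
Proof.
move=> f; rewrite /tpow /apply_op /tens_op [RHS]bigA_distr_bigA /=.
by apply: eq_bigr => g _; rewrite big_split.
Qed.

Lemma inner_tpow u v : inner (@tpow R N I u) (@tpow R N I v) = inner u v ^+ N.
Proof.
rewrite -[in RHS](card_ord N) -prodr_const [RHS]bigA_distr_bigA /=.
by apply: eq_bigr => f _; rewrite /tpow rmorph_prod big_split.
Qed.

Lemma comp_tens A B : comp_op (tens_op A) (tens_op B) =2 tens_op (comp_op A B).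
Proof.
move=> f g; rewrite /tens_op /comp_op [RHS]bigA_distr_bigA /=.
by apply: eq_bigr => h _; rewrite big_split.
Qed.

Lemma adj_tens A : adj_op (tens_op A) =2 tens_op (adj_op A).
Proof. by move=> f g; rewrite /adj_op rmorph_prod. Qed.

Lemma tens_id A : A =2 @idop R I -> tens_op A =2 @idop R (copies N I).
Proof.
move=> eA f g; rewrite /tens_op /idop; case: eqP => [->|/eqP nfg].
  by apply: big1 => k _; rewrite eA /idop eqxx.
have /existsP[k nk] : [exists k, f k != g k].
  apply: contraR nfg; rewrite negb_exists => /forallP h.
  by apply/eqP/ffunP => k; apply/eqP; rewrite -[_ == _]negbK.
by rewrite (bigD1 k) //= eA /idop (negbTE nk) mul0r.
Qed.

Lemma eq_comp (A A' B B' : oper R (copies N I)) :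
  A =2 A' -> B =2 B' -> comp_op A B =2 comp_op A' B'.
Proof. by move=> eA eB x y; apply: eq_bigr => z _; rewrite eA eB. Qed.

Lemma tens_unitary W : unitary_op W -> unitary_op (tens_op W).
Proof.
move=> [h1 h2]; split=> f g.
  by rewrite (eq_comp (adj_tens _) (fun _ _ => erefl)) comp_tens tens_id.
by rewrite (eq_comp (fun _ _ => erefl) (adj_tens _)) comp_tens tens_id.
Qed.

End TensorPowers.

(** * Testers almost fixed by the symmetries of a promise problem *)

Section NearInvariance.
Variables (I : finType) (Q : vec R I -> Prop) (eps : R) (N : nat).
Implicit Types (T : oper R (copies N I)) (W : oper R I).

(** Both sides of the promise must be preserved, since a conjugated tester is evaluated on rotated
    yes- and no-instances alike. *)
Definition symmetry_of W : Prop :=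
  [/\ unitary_op W, forall psi, Q psi -> Q (apply_op W psi)
    & forall phi, no_inst Q eps phi -> no_inst Q eps (apply_op W phi)].

Definition twirl_op W T := pull_op (@tens_op I N W) T.

Lemma sandwich_twirl u W T v :
  sandwich (@tpow R N I u) (twirl_op W T) (@tpow R N I v) =
  sandwich (@tpow R N I (apply_op W u)) T (@tpow R N I (apply_op W v)).
Proof. by rewrite sandwich_pull; apply: eq_sandwich; apply: apply_tens. Qed.

Lemma tester_twirl W T : symmetry_of W -> tester Q eps T -> tester Q eps (twirl_op W T).
Proof.
move=> [uW yW nW] [pT [yT nT]]; split; first exact/povm_pull/pT/tens_unitary.
by split=> psi h; rewrite sandwich_twirl; [apply/yT/yW | apply/nT/nW].
Qed.

Lemma tester_mid T T' : tester Q eps T -> tester Q eps T' ->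
  tester Q eps (fun x y => 2^-1 * T x y + 2^-1 * T' x y).
Proof.
move=> [pT [yT nT]] [pT' [yT' nT']]; split; first exact: povm_mid.
have half (z : R[i]) : 2^-1 * z + 2^-1 * z = z by field.
have h0 : 0 <= 2^-1 :> R[i] by rewrite invr_ge0 ler0n.
split=> psi h; rewrite sandwich_lin.
  by rewrite -[leLHS]half lerD // ler_wpM2l //; [apply: yT | apply: yT'].
by rewrite -[leRHS]half lerD // ler_wpM2l //; [apply: nT | apply: nT'].
Qed.

(* A tester whose Hilbert-Schmidt norm is close to the infimum must be almost
   fixed by every symmetry W, since the midpoint of T and its conjugate by W is
   again a tester.  This replaces averaging over the Haar measure. *)
Lemma near_invariant_tester (eta : R) : 0 < eta -> testable_with Q eps N ->
  exists2 T, tester Q eps T &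
    forall W, symmetry_of W ->
      forall x y, `|T x y - twirl_op W T x y| <= real_complex R eta.
Proof.
move=> eta0 [T0 tT0].
pose E : classical_sets.set R :=
  fun r => exists2 T : oper R (copies N I), tester Q eps T & hs_norm2 T = real_complex R r.
(* The norms are elements of C while the infimum is taken in R, so their real values are extracted
   first. *)
have realE (T : oper R (copies N I)) :
    exists2 r, 0 <= r & hs_norm2 T = real_complex R r.
  have := hs_norm2_ge0 T; case: (hs_norm2 T) => a b.
  by rewrite lecE /= => /andP[/eqP bE a0]; exists a; rewrite // bE.
have infE : classical_sets.has_inf E.
  split; first by have [r _ hr] := realE T0; exists r, T0.
  exists 0 => r [T _ hr]; have [r' r'0] := realE T; rewrite hr => /complexI ->.
  exact: r'0.
(* [T] and its twirl have squared norm below inf E + eta^2/4 and their midpoint at least inf E, so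
   the parallelogram law bounds the squared distance by 4 (eta^2/4). *)
have e0 : 0 < eta ^+ 2 / 4 by rewrite divr_gt0 ?exprn_gt0.
have [r [T tT hr] lt_r] := inf_adherent e0 infE.
exists T => // W sW x y; have tTW := tester_twirl sW tT.
set D := fun x y => T x y - twirl_op W T x y.
pose M : oper R (copies N I) := fun x y => 2^-1 * T x y + 2^-1 * twirl_op W T x y.
have [s s0 hs] := realE M.
have le_s : inf E <= s by apply: ge_inf; [case: infE|exists M => //; exact: tester_mid].
have hD : hs_norm2 D <= real_complex R (eta ^+ 2).
  rewrite parallelogram_hs -/M hs (hs_norm2_pull _ (tens_unitary _ _)); last by case: sW.
  rewrite hr -[2]/(2%:R) -[4]/(4%:R) -!(rmorph_nat (real_complex R)) -!rmorphM /= -!rmorphD -rmorphB lecR.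
  rewrite /=; lra.
have := le_trans (entry_le_hs_norm2 D x y) hD.
rewrite rmorphXn /= ler_pXn2r // nnegrE //.
by rewrite -(rmorph0 (real_complex R)) lecR ltW.
Qed.

End NearInvariance.
End Operators.

(** * Dephasing by roots of unity *)

Section Dephasing.
Variable R : realType.
Local Notation C := (R[i]).

(** X^n - 1 splits over C and is separable in characteristic zero; among its n distinct roots there
    is a primitive one. *)
Lemma prim_root_exists n : (0 < n)%N -> exists z : C, n.-primitive_root z.
Proof.
pose p : {poly C} := 'X^n - 1; have [r Dp] := closed_field_poly_normal p.
move=> n0; rewrite (monicP _) ?monicXnsubC // scale1r in Dp.
have rn1 : all n.-unity_root r by apply/allP=> z; rewrite -root_prod_XsubC -Dp.
have sz_r : (n <= size r)%N.
  by rewrite -ltnS -(size_prod_XsubC r id) -Dp size_XnsubC.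
have ur : uniq r.
  by rewrite -separable_prod_XsubC -Dp separable_Xn_sub_1 // pnatr_eq0 -lt0n.
by have /hasP[z _ hz] := cyclic.has_prim_root n0 rn1 ur sz_r; exists z.
Qed.

Lemma unity_norm1 n (z : C) : (0 < n)%N -> z ^+ n = 1 -> `|z| = 1.
Proof.
move=> n0 zn; apply/eqP; rewrite -(@pexpr_eq1 _ _ n) //.
by rewrite -normrX zn normr1.
Qed.

(** A geometric sum whose ratio z, the conjugate of w^s times w^t, satisfies z^K = 1 and z <> 1. *)
Lemma prim_root_orthogonal K (w : C) s t :
  K.-primitive_root w -> (s < K)%N -> (t < K)%N -> s <> t ->
  \sum_(k < K) ((w ^+ k) ^+ s)^* * (w ^+ k) ^+ t = 0.
Proof.
move=> hw sK tK st; have K0 := prim_order_gt0 hw.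
have nw : `|w| = 1 := unity_norm1 K0 (prim_expr_order hw).
have w0 : w != 0 by rewrite -normr_eq0 nw oner_eq0.
pose z : C := (w ^+ s)^* * w ^+ t.
have zw : w ^+ s * z = w ^+ t by rewrite mulrA -normCK normrX nw !expr1n mul1r.
transitivity (\sum_(k < K) z ^+ k).
  apply: eq_bigr => k _; rewrite exprMn -rmorphXn -!exprM.
  by rewrite ![(k * _)%N]mulnC.
have zK : z ^+ K = 1.
  rewrite exprMn -rmorphXn -!exprM ![(_ * K)%N]mulnC !exprM.
  by rewrite (prim_expr_order hw) !expr1n rmorph1 mulr1.
have z1 : z - 1 != 0.
  rewrite subr_eq0; apply/eqP => z1; move/eqP: zw; rewrite z1 mulr1.
  by rewrite (eq_prim_root_expr hw) !modn_small // => /eqP.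
by apply: (mulfI z1); rewrite -subrX1 zK subrr mulr0.
Qed.

Section TwoVectors.
Variables (I : finType) (N : nat) (p q : vec R I).
Implicit Types (T : oper R (copies N I)).

Definition comb (a b : C) : vec R I := fun x => a * p x + b * q x.
Local Notation tp a b := (@tpow R N I (comb a b)).

(** The terms in the expansion of the N-th tensor power of a p + b q; [S] is the set of copies that
    carry [p]. *)
Definition mixed_tensor (S : {set 'I_N}) : vec R (copies N I) :=
  fun f => \prod_(k < N) if k \in S then p (f k) else q (f k).

Lemma tpow_comb a b f : tp a b f =
  \sum_(S : {set 'I_N}) a ^+ #|S| * b ^+ #|~: S| * mixed_tensor S f.
Proof.
rewrite /tpow /comb bigA_distr; apply: eq_bigr => S _.
rewrite /mixed_tensor -!prodr_const.
rewrite [X in X * _ * _]big_mkcond [X in _ * X * _]big_mkcond -!big_split /=.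
apply: eq_bigr => k _; rewrite inE; case: (k \in S) => /=; ring.
Qed.

Lemma sandwich_comb a b a' b' T : sandwich (tp a b) T (tp a' b') =
  \sum_(S : {set 'I_N}) \sum_(S' : {set 'I_N})
    (a ^+ #|S| * b ^+ #|~: S|)^* * (a' ^+ #|S'| * b' ^+ #|~: S'|)
      * sandwich (mixed_tensor S) T (mixed_tensor S').
Proof.
rewrite /sandwich.
transitivity (\sum_(S : {set 'I_N}) \sum_(S' : {set 'I_N}) \sum_x \sum_y
   (a ^+ #|S| * b ^+ #|~: S| * mixed_tensor S x)^* * T x y *
   (a' ^+ #|S'| * b' ^+ #|~: S'| * mixed_tensor S' y)).
  under [RHS]eq_bigr do rewrite exchange_big /=.
  rewrite [RHS]exchange_big; apply: eq_bigr => x _ /=.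
  under [RHS]eq_bigr do rewrite exchange_big /=.
  rewrite [RHS]exchange_big; apply: eq_bigr => y _ /=.
  rewrite !tpow_comb rmorph_sum !mulr_suml; apply: eq_bigr => S _.
  by rewrite mulr_sumr.
apply: eq_bigr => S _; apply: eq_bigr => S' _.
rewrite !mulr_sumr; apply: eq_bigr => x _; rewrite !mulr_sumr.
by apply: eq_bigr => y _; rewrite !rmorphM /=; ring.
Qed.

(** The sum over phases kills every term with |S| <> |S'|, because sizes up to N < K are distinct
    modulo K. When |S| = |S'|, the coefficient is (a^* a')^|S| (b^* b')^(N - |S|), which depends
    only on the two products. *)
Lemma dephased_sandwich K (w : C) T a b a' b' c d c' d' :
  K.-primitive_root w -> (N < K)%N ->
  a^* * a' = c^* * c' -> b^* * b' = d^* * d' ->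
  \sum_(k < K) sandwich (tp (a * w ^+ k) b) T (tp (a' * w ^+ k) b') =
  \sum_(k < K) sandwich (tp (c * w ^+ k) d) T (tp (c' * w ^+ k) d').
Proof.
move=> hw NK ac bd.
pose t S S' := sandwich (mixed_tensor S) T (mixed_tensor S').
pose coef (a b a' b' : C) (S S' : {set 'I_N}) :=
  (a ^+ #|S| * b ^+ #|~: S|)^* * (a' ^+ #|S'| * b' ^+ #|~: S'|) * t S S'.
have expand a1 b1 a2 b2 :
    \sum_(k < K) sandwich (tp (a1 * w ^+ k) b1) T (tp (a2 * w ^+ k) b2) =
    \sum_(S : {set 'I_N}) \sum_(S' : {set 'I_N}) coef a1 b1 a2 b2 S S' *
      \sum_(k < K) ((w ^+ k) ^+ #|S|)^* * (w ^+ k) ^+ #|S'|.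
  under eq_bigr do rewrite sandwich_comb.
  rewrite exchange_big; apply: eq_bigr => S _ /=.
  rewrite exchange_big; apply: eq_bigr => S' _ /=.
  rewrite mulr_sumr; apply: eq_bigr => k _.
  by rewrite /coef -/(t S S') !exprMn !rmorphM /=; ring.
rewrite !expand; apply: eq_bigr => S _; apply: eq_bigr => S' _.
have cardK (U : {set 'I_N}) : (#|U| < K)%N.
  by apply: leq_ltn_trans NK; rewrite -[X in (_ <= X)%N]card_ord max_card.
have [eSS'|/eqP nSS'] := eqVneq #|S| #|S'|; last first.
  by rewrite (prim_root_orthogonal hw) ?mulr0.
congr (_ * _); rewrite /coef.
have eC : #|~: S| = #|~: S'|.
  by apply/eqP; rewrite -(eqn_add2l #|S|) cardsC {1}eSS' cardsC.
have regroup (x y x' y' : C) :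
    (x ^+ #|S| * y ^+ #|~: S|)^* * (x' ^+ #|S'| * y' ^+ #|~: S'|) =
    (x^* * x') ^+ #|S| * (y^* * y') ^+ #|~: S|.
  by rewrite -eSS' -eC !exprMn rmorphM !rmorphXn /=; ring.
by rewrite !regroup ac bd.
Qed.

Definition l1_norm (J : finType) (u : vec R J) : C := \sum_x `|u x|.

Lemma l1_norm_ge0 (J : finType) (u : vec R J) : 0 <= l1_norm u.
Proof. exact: sumr_ge0. Qed.

(** The l1 norms may be huge in the dimension and in [N]; this is harmless because [eta] is sent to
    0 with the vectors fixed. *)
Lemma sandwich_close (J : finType) (u v : vec R J) (A B : oper R J) (eta : C) :
  (forall x y, `|A x y - B x y| <= eta) ->
  `|sandwich u A v - sandwich u B v| <= eta * (l1_norm u * l1_norm v).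
Proof.
move=> hAB; rewrite /sandwich -sumrB; apply: le_trans (ler_norm_sum _ _ _) _.
rewrite mulrA [eta * _]mulrC -mulrA mulr_suml; apply: ler_sum => x _.
rewrite -sumrB; apply: le_trans (ler_norm_sum _ _ _) _.
rewrite !mulr_sumr; apply: ler_sum => y _.
rewrite -mulrBl -mulrBr !normrM norm_conjC -mulrA ler_wpM2l //.
by rewrite ler_wpM2r.
Qed.

(** Each of the two values is close to all its twirls, and by [dephased_sandwich] the sums of the
    twirls over the K phases coincide. Dividing by K leaves an error independent of K. *)
Lemma sandwich_near_invariant K (w : C) (W : 'I_K -> oper R I) T (eta : C)
    a b a' b' c d c' d' :
  K.-primitive_root w -> (N < K)%N ->
  (forall k x y, apply_op (W k) (comb x y) =1 comb (x * w ^+ k) y) ->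
  (forall k f g, `|T f g - twirl_op (W k) T f g| <= eta) ->
  a^* * a' = c^* * c' -> b^* * b' = d^* * d' ->
  `|sandwich (tp a b) T (tp a' b') - sandwich (tp c d) T (tp c' d')| <=
    eta * (l1_norm (tp a b) * l1_norm (tp a' b')
            + l1_norm (tp c d) * l1_norm (tp c' d')).
Proof.
move=> hw NK hW hT ac bd; have K0 := prim_order_gt0 hw.
have eqtp u v : u =1 v -> @tpow R N I u =1 @tpow R N I v.
  by move=> e f; apply: eq_bigr => k _; rewrite e.
have tw k x y x' y' : sandwich (tp x y) (twirl_op (W k) T) (tp x' y') =
    sandwich (tp (x * w ^+ k) y) T (tp (x' * w ^+ k) y').
  by rewrite sandwich_twirl; apply: eq_sandwich; apply: eqtp; apply: hW.
have K0' : 0 < K%:R :> C by rewrite ltr0n.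
rewrite -(ler_pM2l K0') -{1}(ger0_norm (ltW K0')) -normrM.
set F := sandwich (tp a b) T _; set G := sandwich (tp c d) T _.
have -> : K%:R * (F - G) = \sum_(k < K)
    ((F - sandwich (tp a b) (twirl_op (W k) T) (tp a' b')) -
     (G - sandwich (tp c d) (twirl_op (W k) T) (tp c' d'))).
  rewrite !sumrB; under [X in _ - X - _]eq_bigr do rewrite tw.
  under [X in _ - (_ - X)]eq_bigr do rewrite tw.
  rewrite (dephased_sandwich T hw NK ac bd) !sumr_const card_ord.
  by rewrite -[F *+ K]mulr_natl -[G *+ K]mulr_natl; ring.
apply: le_trans (ler_norm_sum _ _ _) _.
rewrite mulr_natl -[X in _ *+ X]card_ord -sumr_const.
apply: ler_sum => k _; apply: le_trans (ler_normB _ _) _.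
by rewrite mulrDr lerD //; apply: sandwich_close => x y; apply: hT.
Qed.

End TwoVectors.
End Dephasing.

(** * The second-moment bound *)

Section ChiSquare.
Variable R : realType.
Local Notation C := (R[i]).

Section Sesquilinearity.
Variables (J : finType) (A : oper R J).
Implicit Types (u v : vec R J).

Lemma sandwich_linr u v v' (a b : C) :
  sandwich u A (fun x => a * v x + b * v' x) = a * sandwich u A v + b * sandwich u A v'.
Proof.
rewrite /sandwich !mulr_sumr -big_split; apply: eq_bigr => x _ /=.
rewrite !mulr_sumr -big_split; apply: eq_bigr => y _ /=; ring.
Qed.

Lemma sandwich_linl u u' v (a b : C) :
  sandwich (fun x => a * u x + b * u' x) A v =
  a^* * sandwich u A v + b^* * sandwich u' A v.
Proof.
rewrite /sandwich !mulr_sumr -big_split; apply: eq_bigr => x _ /=.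
rewrite !mulr_sumr -big_split; apply: eq_bigr => y _ /=.
by rewrite rmorphD !rmorphM /=; ring.
Qed.

Lemma sandwich_sumr (G : finType) u (v : G -> vec R J) :
  sandwich u A (fun x => \sum_g v g x) = \sum_g sandwich u A (v g).
Proof.
rewrite /sandwich [RHS]exchange_big; apply: eq_bigr => x _ /=.
by rewrite [RHS]exchange_big; apply: eq_bigr => y _ /=; rewrite mulr_sumr.
Qed.

Lemma sandwich_suml (G : finType) (u : G -> vec R J) v :
  sandwich (fun x => \sum_g u g x) A v = \sum_g sandwich (u g) A v.
Proof.
rewrite /sandwich [RHS]exchange_big; apply: eq_bigr => x _ /=.
rewrite [RHS]exchange_big; apply: eq_bigr => y _ /=.
by rewrite rmorph_sum !mulr_suml.
Qed.

End Sesquilinearity.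

Lemma inner_sandwich (J : finType) (u v : vec R J) : inner u v = sandwich u (@idop R J) v.
Proof. by rewrite sandwichE; apply: eq_inner => // x; rewrite apply_id. Qed.

Lemma le_of_forall_eps (A B c : C) : 0 <= c ->
  (forall eta : R, 0 < eta -> A <= B + real_complex R eta * c) -> A <= B.
Proof.
move=> c0 h; rewrite -subr_ge0.
have {}h (eta : R) : 0 < eta -> 0 <= (B - A) + real_complex R eta * c.
  by move=> /h; rewrite -subr_ge0 addrAC.
case: (B - A) h => x y; case: c c0 => cx cy; rewrite lecE /= => /andP[/eqP -> c0] h.
(* Comparable complex numbers have equal imaginary parts, so the instance eta = 1 already forces y =
   0. *)
have := h 1 ltr01; rewrite !lecE /= => /andP[/eqP hy _].
have y0 : y = 0 by rewrite -hy; ring.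
rewrite y0 eqxx /= leNgt; apply/negP => x0.
(* This choice keeps eta c below -x/2, so x + eta c stays negative. *)
have e0 : 0 < - x / (2 * (cx + 1)) by rewrite divr_gt0 ?mulr_gt0 //; lra.
have := h _ e0; rewrite lecE /= => /andP[_].
have -> : x + (- x / (2 * (cx + 1)) * cx - 0 * 0) = x * (cx + 2) / (2 * (cx + 1)).
  by field; apply/eqP; lra.
by rewrite leNgt pmulr_llt0 ?nmulr_rlt0 ?invr_gt0 //; lra.
Qed.

(** * The second-moment inequality for a family of no-instances *)

Section Bound.
Variables (I G : finType) (Q : vec R I -> Prop) (eps : R) (N : nat).
Variables (phi0 : vec R I) (p q : G -> vec R I) (a b : C).
Variable W : G -> C -> oper R I.

Hypothesis G_gt0 : (0 < #|G|)%N.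
Hypothesis a_real : a^* = a.
Hypothesis b_real : b^* = b.
Hypothesis phi0_unit : inner phi0 phi0 = 1.
Hypothesis phi0_yes : Q phi0.
Hypothesis pq_phi0 : forall g, comb (p g) (q g) 1 1 =1 phi0.
Hypothesis ab_no : forall g, no_inst Q eps (comb (p g) (q g) a b).
Hypothesis W_sym : forall g z, `|z| = 1 -> symmetry_of Q eps (W g z).
Hypothesis W_comb : forall g z x y,
  apply_op (W g z) (comb (p g) (q g) x y) =1 comb (p g) (q g) (x * z) y.

(** If a, b are the levels of the square root of a state, these are the levels of the state itself;
    the next two hypotheses then express its normalisation. *)
Local Notation rho g := (comb (p g) (q g) (a ^+ 2) (b ^+ 2)).
Hypothesis rho_phi0 : forall g, inner (rho g) phi0 = 1.
Hypothesis phi0_rho : forall g, inner phi0 (rho g) = 1.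

(** Let x, y_g, m_g be the N-fold powers of phi0, rho g and the no-instance g, and let v be the mean
    of the y_g minus x, so that |v|^2 is [chi2]. Near-invariance makes <m_g|T|m_g> almost equal to
    <x|T|y_g> and to <y_g|T|x>. Positivity of T at x + 3v, with <v|T|v> <= |v|^2, then contradicts
    the acceptance gap unless [chi2] is large. *)
Lemma chi_square_bound : testable_with Q eps N ->
  4 / 27 <= #|G|%:R ^- 2 * (\sum_g \sum_h inner (rho g) (rho h) ^+ N) - 1 :> C.
Proof.
move=> hT; set chi2 : C := _ - 1.
pose tp u := @tpow R N I u.
have eqtp u v : u =1 v -> tp u =1 tp v.
  by move=> e f; apply: eq_bigr => k _; rewrite e.
pose x := tp phi0; pose y g := tp (rho g); pose m g := tp (comb (p g) (q g) a b).
pose mu : C := #|G|%:R^-1.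
have G0 : #|G|%:R != 0 :> C by rewrite pnatr_eq0 -lt0n.
have mu0 : 0 <= mu by rewrite invr_ge0 ler0n.
have mu_real : mu^* = mu by rewrite fmorphV rmorph_nat.
have mu_sum (z : C) : mu * \sum_(g : G) z = z.
  by rewrite sumr_const -mulr_natl mulrA mulVf ?mul1r.
pose c1 g := l1_norm (m g) * l1_norm (m g) + l1_norm (tp (comb (p g) (q g) 1 1)) * l1_norm (y g).
pose c2 g := l1_norm (m g) * l1_norm (m g) + l1_norm (y g) * l1_norm (tp (comb (p g) (q g) 1 1)).
have c_ge0 g : 0 <= c1 g + c2 g.
  by rewrite /c1 /c2 !addr_ge0 // mulr_ge0 // l1_norm_ge0.
pose c := 3 * (mu * \sum_g (c1 g + c2 g)).
have c0 : 0 <= c.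
  by rewrite mulr_ge0 ?ler0n // mulr_ge0 //; apply: sumr_ge0 => g _; apply: c_ge0.
suff : 4 / 3 <= 9 * chi2.
  move=> h; rewrite -(@ler_pM2l _ 9) ?ltr0n //; apply: le_trans h.
  by rewrite le_eqVlt; apply/orP; left; apply/eqP; field.
(* The tester obtained next depends on [eta], but [chi2] and [c] do not, so [eta] may tend to 0 once
   T is eliminated. *)
apply: (le_of_forall_eps c0) => eta eta0.
have [T [[T0 T1] [yT nT]] inv] := near_invariant_tester eta0 hT.
pose S u v := sandwich u T v.
have [K NK] : exists K, (N < K)%N by exists N.+1.
have [w hw]  := prim_root_exists R (leq_ltn_trans (leq0n _) NK).
have nw k : `|w ^+ k| = 1.
  by rewrite normrX (unity_norm1 (leq_ltn_trans (leq0n _) NK) (prim_expr_order hw)) expr1n.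
have near g a1 b1 a2 b2 c1' d1 c2' d2 := @sandwich_near_invariant R I N (p g) (q g) K w
  (fun k => W g (w ^+ k)) T (real_complex R eta) a1 b1 a2 b2 c1' d1 c2' d2 hw NK
  (fun k x' y' => W_comb g (w ^+ k) x' y')
  (fun k f f' => inv _ (W_sym g (nw k)) f f').
(* Levels (a, b) on both sides are traded for (1, 1) and (a^2, b^2): the products a a = 1 a^2 and b
   b = 1 b^2 agree. *)
have n1 g : `|S (m g) (m g) - S x (y g)| <= real_complex R eta * c1 g.
  have -> : S x (y g) = S (tp (comb (p g) (q g) 1 1)) (y g).
    by apply: eq_sandwich => //; apply: eqtp => t; rewrite pq_phi0.
  by apply: near; rewrite ?a_real ?b_real rmorph1 mul1r expr2.
have n2 g : `|S (m g) (m g) - S (y g) x| <= real_complex R eta * c2 g.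
  have -> : S (y g) x = S (y g) (tp (comb (p g) (q g) 1 1)).
    by apply: eq_sandwich => //; apply: eqtp => t; rewrite pq_phi0.
  by apply: near; rewrite ?rmorphXn /= ?a_real ?b_real mulr1 expr2.
pose v : vec R (copies N I) := fun f => mu * (\sum_g y g f) + (- 1) * x f.
(* With weight 3 positivity reads 0 <= -5 (2/3) + 6 (1/3) + 9 chi2 up to the error, that is, chi2 >=
   4/27. *)
pose z : vec R (copies N I) := fun f => 1 * x f + 3 * v f.
have vr u A : sandwich u A v = mu * (\sum_g sandwich u A (y g)) - sandwich u A x.
  by rewrite sandwich_linr sandwich_sumr mulN1r.
have vl u A : sandwich v A u = mu * (\sum_g sandwich (y g) A u) - sandwich x A u.
  by rewrite sandwich_linl sandwich_suml rmorphN rmorph1 mulN1r mu_real.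
have v_norm : inner v v = chi2.
  rewrite inner_sandwich vl vr.
  have yy g h : sandwich (y g) (@idop R _) (y h) = inner (rho g) (rho h) ^+ N.
    by rewrite -inner_sandwich inner_tpow.
  have yx g : sandwich (y g) (@idop R _) x = 1.
    by rewrite -inner_sandwich inner_tpow rho_phi0 expr1n.
  have xy g : sandwich x (@idop R _) (y g) = 1.
    by rewrite -inner_sandwich inner_tpow phi0_rho expr1n.
  have xx : sandwich x (@idop R _) x = 1.
    by rewrite -inner_sandwich inner_tpow phi0_unit expr1n.
  under eq_bigr do rewrite vr yx; rewrite xx.
  under [X in _ - (mu * X - _)]eq_bigr do rewrite xy.
  rewrite sumrB mulrBr !mu_sum subrr subr0 -mulr_sumr mulrA /chi2 -expr2 exprVn.
  congr (_ * _ - 1); apply: eq_bigr => g _; apply: eq_bigr => h _; exact: yy.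
have Svv_ge0 : 0 <= S v v := T0 v.
have Svv : S v v <= chi2.
  by move: (T1 v); rewrite sandwich_idB v_norm subr_ge0.
have Sxx : 2 / 3 <= S x x.
  by move: (yT _ phi0_yes); rewrite rmorphM fmorphV !rmorph_nat.
have Smm g : S (m g) (m g) <= 1 / 3.
  by move: (nT _ (ab_no g)); rewrite rmorphM fmorphV rmorph_nat rmorph1.
pose E := 3 * (mu * \sum_g (S x (y g) + S (y g) x - (S (m g) (m g) + S (m g) (m g)))).
pose M := mu * \sum_g S (m g) (m g).
have Szz : S z z = - (5 * S x x) + 6 * M + 9 * S v v + E.
  have zr u : S u z = S u x + 3 * S u v by rewrite /S sandwich_linr mul1r.
  have zl u : S z u = S x u + 3 * S v u.
    by rewrite /S sandwich_linl rmorph1 rmorph_nat mul1r.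
  have Sxv : S x v = mu * (\sum_g S x (y g)) - S x x := vr x T.
  have Svx : S v x = mu * (\sum_g S (y g) x) - S x x := vl x T.
  rewrite zr !zl Sxv Svx /E /M sumrB !big_split /=; ring.
have E_le : E <= real_complex R eta * c.
  have : `|E| <= real_complex R eta * c.
    rewrite /E /c [leRHS]mulrCA !normrM (ger0_norm (ler0n _ _)) ler_wpM2l ?ler0n //.
    rewrite (ger0_norm mu0) [leRHS]mulrCA ler_wpM2l // mulr_sumr.
    apply: le_trans (ler_norm_sum _ _ _) _; apply: ler_sum => g _.
    rewrite opprD addrACA mulrDr; apply: le_trans (ler_normD _ _) _.
    by rewrite lerD // distrC.
  apply: le_trans; apply: real_ler_norm.
  (* Bounding E by its norm requires E to be real; [Szz] exhibits it as a combination of numbers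
     that are real by positivity of T. *)
  have -> : E = S z z - (- (5 * S x x) + 6 * M + 9 * S v v) by rewrite Szz; ring.
  have M0 : 0 <= M by rewrite mulr_ge0 //; apply: sumr_ge0 => g _; apply: T0.
  apply: realB; first exact/ger0_real/T0.
  apply: realD; last by apply/ger0_real; rewrite mulr_ge0 ?ler0n.
  apply: realD; last by apply/ger0_real; rewrite mulr_ge0 ?ler0n.
  by rewrite realN; apply/ger0_real; rewrite mulr_ge0 ?ler0n //; apply: T0.
have M_le : M <= 1 / 3.
  by rewrite -[leRHS]mu_sum ler_wpM2l //; apply: ler_sum => g _; apply: Smm.
have : 0 <= - (5 * (2 / 3)) + 6 * (1 / 3) + 9 * chi2 + real_complex R eta * c.
  apply: le_trans (T0 z) _; rewrite -/(S z z) Szz lerD // lerD ?ler_wpM2l ?ler0n //.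
  by rewrite lerD ?lerN2 ?ler_wpM2l ?ler0n.
move=> h; rewrite -subr_ge0; apply: le_trans h _.
by rewrite le_eqVlt; apply/orP; left; apply/eqP; field.
Qed.

End Bound.
End ChiSquare.

(** * Fixed points of random permutations *)

Section FixedPoints.
Variable R : realType.
Implicit Types alpha s : R.

Definition fixpoints m (t : 'S_m) : {set 'I_m} := [set i | t i == i].

(** Expand the power over the subsets S of the fixed points and exchange the sums: (m - |S|)!
    permutations fix S pointwise, which [perm_on (~: S)] expresses. *)
Lemma sum_exp_fixpoints m alpha : \sum_(t : 'S_m) (1 + alpha) ^+ #|fixpoints t| =
  \sum_(S : {set 'I_m}) alpha ^+ #|S| * (m - #|S|)`!%:R.
Proof.
transitivity (\sum_(t : 'S_m) \sum_(S : {set 'I_m}) alpha ^+ #|S| * (perm_on (~: S) t)%:R).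
  apply: eq_bigr => t _.
  transitivity (\prod_i ((if i \in fixpoints t then alpha else 0) + 1)).
    rewrite -prodr_const big_mkcond /=; apply: eq_bigr => i _.
    by case: ifP; rewrite ?add0r // addrC.
  rewrite bigA_distr; apply: eq_bigr => S _; rewrite -big_mkcond /=.
  have [/subsetP hS|hS] := boolP (perm_on (~: S) t); last first.
    have [i ti iS] : exists2 i, t i != i & i \in S.
      case/subsetPn: hS => i; rewrite !inE => h1 h2; exists i => //.
      by move: h2; rewrite negbK.
    by rewrite (bigD1 i) //= inE (negbTE ti) mul0r mulr0.
  rewrite mulr1 -prodr_const; apply: eq_bigr => i iS.
  rewrite inE; case: eqP => // /eqP ti.
  by have := hS i; rewrite !inE iS ti => /(_ isT).
rewrite exchange_big; apply: eq_bigr => S _ /=; rewrite -mulr_sumr; congr (_ * _).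
have -> : (m - #|S| = #|~: S|)%N by rewrite [RHS]cardsCs setCK card_ord.
rewrite -card_perm -sum1_card natr_sum [RHS]big_mkcond; apply: eq_bigr => t _ /=.
by rewrite unfold_in -/(perm_on _ _); case: (perm_on _ _).
Qed.

(** The sets of size k contribute bin(m, k) (m - k)! = m!/k! <= m! times alpha^k, and a geometric
    series remains. *)
Lemma sum_exp_fixpoints_le m alpha : 0 <= alpha -> alpha < 1 ->
  \sum_(t : 'S_m) (1 + alpha) ^+ #|fixpoints t| <= m`!%:R / (1 - alpha).
Proof.
move=> a0 a1; rewrite sum_exp_fixpoints.
rewrite (partition_big (fun S : {set 'I_m} => inord #|S| : 'I_m.+1) xpredT) //=.
apply: (@le_trans _ _ (\sum_(k < m.+1) m`!%:R * alpha ^+ k)).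
  apply: ler_sum => k _.
  have eS (S : {set 'I_m}) : (inord #|S| == k :> 'I_m.+1) = (#|S| == k).
    rewrite -val_eqE /= inordK // ltnS -[X in (_ <= X)%N]card_ord; exact: max_card.
  rewrite (eq_bigl _ _ eS) (eq_bigr (fun=> alpha ^+ k * (m - k)`!%:R)); last first.
    by move=> S /eqP ->.
  rewrite sumr_const -cardsE card_draws card_ord -[leLHS]mulr_natl mulrCA mulrC.
  rewrite ler_wpM2r ?exprn_ge0 // -natrM ler_nat.
  have km : (k <= m)%N by rewrite -ltnS.
  rewrite -(bin_fact km) leq_mul2l; apply/orP; right.
  by rewrite leq_pmull // fact_gt0.
have a1' : 0 < 1 - alpha by rewrite subr_gt0.
rewrite -mulr_sumr ler_wpM2l ?ler0n // -(ler_pM2l a1') divff ?gt_eqF //.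
by rewrite -opprB mulNr -subrX1 opprB lerBlDr lerDl exprn_ge0.
Qed.

(** A division-free form of (1 + s)^N <= 1/(1 - N s), valid whatever the sign of 1 - N s. *)
Lemma expD1_le s N : 0 <= s -> (1 + s) ^+ N * (1 - N%:R * s) <= 1.
Proof.
move=> s0; elim: N => [|N IH]; first by rewrite expr0 mul0r subr0 mulr1.
apply: le_trans IH; rewrite exprSr -mulrA ler_wpM2l ?exprn_ge0 ?addr_ge0 //.
by rewrite -natr1; have := ler0n R N; nra.
Qed.

Lemma bernoulli_le s n : 0 <= s -> 1 + s * n%:R <= (1 + s) ^+ n.
Proof.
move=> s0; elim: n => [|n IH]; first by rewrite mulr0 addr0 expr0.
rewrite exprSr -natr1; have := ler0n R n.
have : 0 <= (1 + s) ^+ n by rewrite exprn_ge0 ?addr_ge0.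
by move: IH; move: ((1 + s) ^+ n) => z; nra.
Qed.

(** The hypothesis on N s gives (1 + s)^N <= 1 + alpha. By Bernoulli 1 + s (f + 1) <= (1 + s)^(f +
    1), so each term is at most (1 + alpha)^(f + 1). *)
Lemma average_power_le m N s alpha : 0 <= s -> 0 < alpha -> alpha < 1 ->
  N%:R * s * (1 + alpha) <= alpha ->
  \sum_(t : 'S_m) (1 + s * #|fixpoints t|.+1%:R) ^+ N
    <= m`!%:R * ((1 + alpha) / (1 - alpha)).
Proof.
move=> s0 a0 a1 Ns.
have base : (1 + s) ^+ N <= 1 + alpha.
  have h := expD1_le N s0; have : 0 <= (1 + s) ^+ N by rewrite exprn_ge0 ?addr_ge0.
  by move: h; move: ((1 + s) ^+ N) (N%:R * s) Ns => z w; nra.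
apply: (@le_trans _ _ (\sum_(t : 'S_m) (1 + alpha) * (1 + alpha) ^+ #|fixpoints t|)).
  apply: ler_sum => t _; rewrite -exprS.
  apply: (@le_trans _ _ (((1 + s) ^+ #|fixpoints t|.+1) ^+ N)).
    by rewrite lerXn2r ?nnegrE ?bernoulli_le ?exprn_ge0 ?addr_ge0 ?mulr_ge0.
  by rewrite exprAC lerXn2r ?nnegrE ?exprn_ge0 ?addr_ge0 ?(ltW a0).
rewrite -mulr_sumr [leRHS]mulrCA ler_wpM2l ?addr_ge0 ?(ltW a0) //.
exact: sum_exp_fixpoints_le (ltW a0) a1.
Qed.

End FixedPoints.

(** * Bipartite states as matrices *)

Section Bipartite.
Variable R : realType.
Local Notation C := (R[i]).

Definition adjmx m n (A : 'M[C]_(m, n)) : 'M[C]_(n, m) := (map_mx Num.conj A)^T.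

Variable d : nat.
Hypothesis d_gt0 : (0 < d)%N.
Implicit Types (A B V P : 'M[C]_d) (psi : vec R (bip d)).

Let d_neq0 : d%:R != 0 :> C.
Proof. by rewrite pnatr_eq0 -lt0n. Qed.

Definition scale : C := (sqrtC d%:R)^-1.

Lemma scale_ge0 : 0 <= scale.
Proof. by rewrite invr_ge0 sqrtC_ge0 ler0n. Qed.

Lemma scale_real : scale^* = scale.
Proof. exact/CrealP/ger0_real/scale_ge0. Qed.

Lemma scale2 : scale * scale = d%:R^-1.
Proof. by rewrite -expr2 exprVn sqrtCK. Qed.

(** Normalised vectorisation: the identity becomes the standard maximally entangled state, and inner
    products become tr(A^* B)/d. *)
Definition bvec A : vec R (bip d) := fun x => scale * A x.1 x.2.
Definition vmx psi : 'M[C]_d := \matrix_(i, j) psi (i, j).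
(** This is 1 tensor V^T, a local operator on the second factor; on the matrix of a state it is
    right multiplication by V. *)
Definition rmul_op V : oper R (bip d) := fun x y => (x.1 == y.1)%:R * V y.2 x.2.

Lemma sum_bip (F : bip d -> C) : \sum_x F x = \sum_i \sum_j F (i, j).
Proof. by rewrite pair_bigA /=; apply: eq_bigr; case. Qed.

Lemma inner_bvec A B : inner (bvec A) (bvec B) = \tr (adjmx A *m B) / d%:R.
Proof.
rewrite /inner sum_bip exchange_big /= mulr_suml; apply: eq_bigr => j _.
rewrite mxE mulr_suml; apply: eq_bigr => i _.
by rewrite !mxE /bvec rmorphM /= scale_real -scale2; ring.
Qed.

Lemma apply_rmul V psi x : apply_op (rmul_op V) psi x = (vmx psi *m V) x.1 x.2.
Proof.
rewrite /apply_op sum_bip mxE (bigD1 x.1) //= [X in _ + X]big1 ?addr0.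
  by apply: eq_bigr => j _; rewrite /rmul_op eqxx mul1r mxE mulrC.
move=> i /negbTE ni; apply: big1 => j _.
by rewrite /rmul_op /= eq_sym ni !mul0r.
Qed.

Lemma apply_rmul_bvec V A : apply_op (rmul_op V) (bvec A) =1 bvec (A *m V).
Proof.
move=> x; rewrite apply_rmul /bvec !mxE mulr_sumr; apply: eq_bigr => j _.
by rewrite mxE mulrA.
Qed.

Lemma comp_rmul V V' : comp_op (rmul_op V) (rmul_op V') =2 rmul_op (V' *m V).
Proof.
move=> x y; rewrite /comp_op sum_bip /rmul_op (bigD1 x.1) //= [X in _ + X]big1 ?addr0.
  rewrite mxE mulr_sumr; apply: eq_bigr => j _.
  by rewrite eqxx mul1r mulrCA [V _ _ * _]mulrC.
move=> i /negbTE ni; apply: big1 => j _.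
by rewrite eq_sym ni !mul0r.
Qed.

Lemma adj_rmul V : adj_op (rmul_op V) =2 rmul_op (adjmx V).
Proof.
by move=> x y; rewrite /adj_op /rmul_op rmorphM rmorph_nat eq_sym !mxE.
Qed.

Lemma rmul1 : rmul_op 1%:M =2 @idop R (bip d).
Proof.
case=> i j [i' j']; rewrite /rmul_op /idop mxE xpair_eqE /= -natrM.
by rewrite [j' == j]eq_sym mulnb.
Qed.

Definition is_unitary_mx V : Prop := V *m adjmx V = 1%:M.

Lemma adjmxK V : adjmx (adjmx V) = V.
Proof. by apply/matrixP => i j; rewrite !mxE conjCK. Qed.

Lemma adjmxM A B : adjmx (A *m B) = adjmx B *m adjmx A.
Proof. by rewrite /adjmx map_mxM trmx_mul. Qed.

Lemma is_unitary_adjmx V : is_unitary_mx V -> is_unitary_mx (adjmx V).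
Proof. by rewrite /is_unitary_mx adjmxK => /mulmx1C. Qed.

Lemma rmul_unitary V : is_unitary_mx V -> unitary_op (rmul_op V).
Proof.
move=> VV; have VV' := mulmx1C VV.
split=> x y.
  rewrite /comp_op; under eq_bigr do rewrite adj_rmul.
  by rewrite -/(comp_op _ _ x y) comp_rmul VV rmul1.
rewrite /comp_op; under eq_bigr do rewrite adj_rmul.
by rewrite -/(comp_op _ _ x y) comp_rmul VV' rmul1.
Qed.

Lemma ptraceBE psi i i' : ptraceB psi i i' = (vmx psi *m adjmx (vmx psi)) i i'.
Proof. by rewrite mxE; apply: eq_bigr => j _; rewrite !mxE. Qed.

(** The reduced state M M^* does not change when M becomes M V. *)
Lemma max_ent_rmul V psi : is_unitary_mx V -> max_ent psi -> max_ent (apply_op (rmul_op V) psi).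
Proof.
move=> VV [h1 h2]; split; first by rewrite /unit_vec (inner_unitary _ _ (rmul_unitary VV)).
move=> i i'; rewrite -h2 !ptraceBE.
have -> : vmx (apply_op (rmul_op V) psi) = vmx psi *m V.
  by apply/matrixP => k l; rewrite mxE apply_rmul.
by rewrite adjmxM mulmxA -[_ *m V *m _]mulmxA VV mulmx1.
Qed.

(** For no-instances the rotation is moved to the other argument of the inner product, where its
    adjoint again preserves maximal entanglement. *)
Lemma symmetry_rmul V eps : is_unitary_mx V -> symmetry_of (@max_ent R d) eps (rmul_op V).
Proof.
move=> VV; split; [exact: rmul_unitary | by move=> psi; apply: max_ent_rmul|].
move=> phi [u1 far]; split; first by rewrite /unit_vec (inner_unitary _ _ (rmul_unitary VV)).
move=> psi /(max_ent_rmul (is_unitary_adjmx VV)) /far.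
rewrite /tdist -inner_adj; congr (_ <= sqrtC (1 - `|_| ^+ 2)).
apply: eq_inner => // x; apply: eq_apply => // y z.
by rewrite adj_rmul adjmxK.
Qed.

Lemma max_ent_bvec1 : max_ent (bvec 1%:M).
Proof.
have adj1 : adjmx 1%:M = 1%:M :> 'M[C]_d by rewrite /adjmx map_mx1 trmx1.
split; first by rewrite /unit_vec inner_bvec adj1 mulmx1 mxtrace1 divff.
move=> i i'; rewrite ptraceBE.
have -> : vmx (bvec 1%:M) = scale *: 1%:M by apply/matrixP => k l; rewrite mxE /bvec !mxE.
rewrite mxE (bigD1 i) //= big1 ?addr0.
  by rewrite !mxE eqxx /= mulr1 rmorphM /= scale_real rmorph_nat mulrA scale2 eq_sym mulrC.
by move=> j /negbTE; rewrite !mxE eq_sym => ->; rewrite mulr0 mul0r.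
Qed.

Section Projector.
Variable P : 'M[C]_d.
Hypothesis P_idem : P *m P = P.
Hypothesis P_adj : adjmx P = P.

(* Cauchy-Schwarz for tr(V^* P) = tr((P V)^* P): both factors have squared norm
   tr P, so the arithmetic-geometric mean inequality is enough. *)
Lemma max_ent_projector psi : max_ent psi -> `|inner psi (bvec P)| <= \tr P / d%:R.
Proof.
move=> [_ hp]; pose X := P *m vmx psi.
have XX : X *m adjmx X = d%:R^-1 *: P.
  have -> : X *m adjmx X = P *m (vmx psi *m adjmx (vmx psi)) *m adjmx P.
    by rewrite /X adjmxM !mulmxA.
  have -> : vmx psi *m adjmx (vmx psi) = d%:R^-1 *: 1%:M.
    apply/matrixP => i j; rewrite -ptraceBE hp mxE [in RHS]mxE mulrC.
    by rewrite mulrC.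
  by rewrite -scalemxAr -scalemxAl mulmx1 P_adj P_idem.
have norm2 A : \sum_i \sum_j `|A i j| ^+ 2 = \tr (A *m adjmx A).
  apply: eq_bigr => i _; rewrite mxE; apply: eq_bigr => j _.
  by rewrite normCK !mxE.
have -> : inner psi (bvec P) = \sum_i \sum_j (X i j)^* * (scale * P i j).
  have -> : inner psi (bvec P) = scale * \tr (adjmx (vmx psi) *m P).
    rewrite /inner sum_bip exchange_big /= mulr_sumr; apply: eq_bigr => j _.
    rewrite mxE mulr_sumr; apply: eq_bigr => i _.
    by rewrite !mxE mulrCA.
  rewrite -{1}P_idem mulmxA -{1}P_adj -adjmxM -/X exchange_big mulr_sumr.
  apply: eq_bigr => j _; rewrite mxE mulr_sumr; apply: eq_bigr => i _.
  by rewrite !mxE mulrCA.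
apply: le_trans (_ : \sum_i \sum_j 2^-1 * (`|X i j| ^+ 2 + d%:R^-1 * `|P i j| ^+ 2) <= _).
  apply: le_trans (ler_norm_sum _ _ _) _; apply: ler_sum => i _.
  apply: le_trans (ler_norm_sum _ _ _) _; apply: ler_sum => j _.
  rewrite !normrM norm_conjC (ger0_norm scale_ge0) -scale2.
  rewrite -(@ler_pM2l _ 2) ?ltr0n // [leRHS]mulrA divff ?pnatr_eq0 // mul1r -subr_ge0.
  set u := `|X i j|; set v := `|P i j|.
  have -> : u ^+ 2 + scale * scale * v ^+ 2 - 2 * (u * (scale * v)) = (u - scale * v) ^+ 2 by ring.
  by rewrite real_exprn_even_ge0 // realB ?realM ?normr_real // ger0_real ?scale_ge0.
under eq_bigr do rewrite -mulr_sumr big_split /= -mulr_sumr.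
rewrite -mulr_sumr big_split /= -mulr_sumr !norm2 XX P_adj P_idem mxtraceZ.
by rewrite le_eqVlt; apply/orP; left; apply/eqP; field; exact: d_neq0.
Qed.

End Projector.
End Bipartite.

(** * Two-level spectra *)

Section TwoLevel.
Variable R : realType.
Local Notation C := (R[i]).
Variable d : nat.
Hypothesis d_gt0 : (0 < d)%N.

(** This is x P + y (1 - P), arranged so that traces of products involve only tr P, tr P' and tr(P
    P'). *)
Definition two_level (P : 'M[C]_d) (x y : C) : 'M[C]_d := y%:M + (x - y) *: P.

Lemma comb_bvec P x y :
  comb (bvec P) (bvec (1%:M - P)) x y =1 bvec (two_level P x y).
Proof. by move=> i; rewrite /comb /bvec /two_level !mxE; case: eqP => _ /=; ring. Qed.

Section OneProjector.
Variable P : 'M[C]_d.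
Hypothesis P_idem : P *m P = P.
Hypothesis P_adj : adjmx P = P.

Lemma two_level_mul x y x' y' :
  two_level P x y *m two_level P x' y' = two_level P (x * x') (y * y').
Proof.
rewrite /two_level mulmxDl !mulmxDr !mul_scalar_mx mul_mx_scalar scale_scalar_mx.
rewrite -scalemxAl -scalemxAr P_idem !scalerA -!addrA -!scalerDl.
by congr (_ + _ *: _); ring.
Qed.

Lemma two_level_adj x y : adjmx (two_level P x y) = two_level P x^* y^*.
Proof.
rewrite -[in RHS]P_adj; apply/matrixP => i j; rewrite !mxE !rmorphD !rmorphM /= rmorphB.
by rewrite eq_sym rmorphMn.
Qed.

(** These are the dephasing unitaries: phase z on the range of P and 1 on its complement. *)
Lemma two_level_unitary z : `|z| = 1 -> is_unitary_mx (two_level P z 1).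
Proof.
move=> z1; rewrite /is_unitary_mx two_level_adj two_level_mul rmorph1 mulr1 -normCK z1.
by rewrite expr1n /two_level subrr scale0r addr0.
Qed.

Lemma proj_compl_idem : (1%:M - P) *m (1%:M - P) = 1%:M - P.
Proof. by rewrite mulmxBl !mulmxBr !mulmx1 mul1mx P_idem subrr subr0. Qed.

Lemma proj_compl_adj : adjmx (1%:M - P) = 1%:M - P.
Proof.
rewrite -[in RHS]P_adj; apply/matrixP => i j; rewrite !mxE rmorphB /=.
by rewrite eq_sym rmorph_nat.
Qed.

End OneProjector.

Lemma inner_two_level P P' x y x' y' :
  adjmx P = P -> x^* = x -> y^* = y ->
  inner (bvec (two_level P x y)) (bvec (two_level P' x' y')) =
  (y * y' * d%:R + y * (x' - y') * \tr P' + (x - y) * y' * \tr P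
     + (x - y) * (x' - y') * \tr (P *m P')) / d%:R.
Proof.
move=> aP rx ry; rewrite inner_bvec // two_level_adj // rx ry; congr (_ / _).
rewrite /two_level mulmxDl !mulmxDr !mul_scalar_mx mul_mx_scalar scale_scalar_mx.
rewrite -scalemxAl -scalemxAr !mxtraceD mxtrace_scalar !mxtraceZ !addrA.
rewrite -mulr_natr; ring.
Qed.

End TwoLevel.

(* P_s projects onto the span of the vectors e_i + e_(m + s i), i < m. *)
Section PairingProjectors.
Variable R : realType.
Local Notation C := (R[i]).
Variables d m : nat.
Hypothesis le_2m_d : (m + m <= d)%N.
Implicit Types s t : 'S_m.

Definition low_mx : 'M[C]_(d, m) := \matrix_(i, j) (i == j :> nat)%:R.
Definition high_mx : 'M[C]_(d, m) := \matrix_(i, j) (i == m + j :> nat)%N%:R.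
(** Column j is e_j + e_(m + i), where s i = j. The columns are orthogonal with squared norm 2,
    whence the factor 1/2 in [pair_proj]. *)
Definition pair_mx s : 'M[C]_(d, m) := low_mx + high_mx *m perm_mx s.
Definition pair_proj s : 'M[C]_d := 2^-1 *: (pair_mx s *m (pair_mx s)^T).

(** Treats all Gram blocks at once: [low_mx] is the shift by 0 and [high_mx] the shift by m. *)
Lemma shift_gram (h k : nat) : (h + m <= d)%N -> (k + m <= d)%N ->
  (\matrix_(i < d, j < m) (i == h + j :> nat)%N%:R)^T *m
    (\matrix_(i < d, j < m) (i == k + j :> nat)%N%:R)
  = \matrix_(i < m, j < m) (h + i == k + j)%N%:R :> 'M[C]_m.
Proof.
move=> hd kd; apply/matrixP => i j; rewrite !mxE.
have hi : (h + i < d)%N by apply: leq_trans hd; rewrite ltn_add2l.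
rewrite (bigD1 (Ordinal hi)) //= !mxE eqxx mul1r big1 ?addr0 //.
by move=> l; rewrite -val_eqE /= !mxE => /negbTE ->; rewrite mul0r.
Qed.

(** The low and high blocks have orthogonal ranges, so the cross terms vanish. *)
Lemma pair_gram s t : (pair_mx s)^T *m pair_mx t = 1%:M + perm_mx (s^-1 * t)%g.
Proof.
have md : (0 + m <= d)%N by apply: leq_trans le_2m_d; rewrite leq_add2r.
have eL : low_mx = \matrix_(i < d, j < m) (i == 0 + j :> nat)%N%:R by [].
have LL : low_mx^T *m low_mx = 1%:M.
  by rewrite eL shift_gram //; apply/matrixP => i j; rewrite !mxE -val_eqE.
have HH : high_mx^T *m high_mx = 1%:M.
  by rewrite shift_gram //; apply/matrixP => i j; rewrite !mxE eqn_add2l -val_eqE.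
have LH : low_mx^T *m high_mx = 0.
  rewrite eL shift_gram //; apply/matrixP => i j; rewrite !mxE add0n.
  by rewrite ltn_eqF // (leq_trans (ltn_ord i)) // leq_addr.
have HL : high_mx^T *m low_mx = 0 by rewrite -[RHS]trmx0 -LH trmx_mul trmxK.
rewrite /pair_mx [(_ + _)^T]linearD /= mulmxDl !mulmxDr LL trmx_mul.
rewrite [low_mx^T *m _]mulmxA LH mul0mx addr0 -[_ *m _ *m low_mx]mulmxA HL mulmx0 add0r.
by rewrite mulmxA -[_ *m high_mx^T *m _]mulmxA HH mulmx1 tr_perm_mx perm_mxM.
Qed.

Lemma pair_proj_idem s : pair_proj s *m pair_proj s = pair_proj s.
Proof.
rewrite /pair_proj -scalemxAl -scalemxAr scalerA mulmxA -[_ *m _ *m pair_mx s]mulmxA.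
rewrite pair_gram mulVg perm_mx1 mulmxDr mulmx1 mulmxDl scalerDr -scalerDl.
by congr (_ *: _); field.
Qed.

Lemma pair_proj_adj s : adjmx (pair_proj s) = pair_proj s.
Proof.
have conjU : map_mx Num.conj (pair_mx s) = pair_mx s.
  have conjL : map_mx Num.conj low_mx = low_mx.
    by apply/matrixP => i j; rewrite !mxE rmorph_nat.
  have conjH : map_mx Num.conj high_mx = high_mx.
    by apply/matrixP => i j; rewrite !mxE rmorph_nat.
  by rewrite /pair_mx map_mxD map_mxM map_perm_mx conjL conjH.
rewrite /adjmx /pair_proj map_mxZ map_mxM -map_trmx conjU linearZ /= trmx_mul trmxK.
by rewrite fmorphV rmorph_nat.
Qed.

Lemma tr_perm_mx_fixpoints t : \tr (perm_mx t : 'M[C]_m) = #|fixpoints t|%:R.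
Proof.
rewrite -sum1_card natr_sum [RHS]big_mkcond; apply: eq_bigr => i _ /=.
by rewrite !mxE inE; case: eqP.
Qed.

Lemma tr_pair_proj s : \tr (pair_proj s) = m%:R.
Proof.
rewrite /pair_proj mxtraceZ mxtrace_mulC pair_gram mulVg perm_mx1 mxtraceD mxtrace1.
by field.
Qed.

(** By cyclicity the trace is tr((1 + A^-1) (1 + A)) / 4 with A the matrix of s^-1 t, and A and A^-1
    have the same trace. *)
Lemma tr_pair_projM s t :
  \tr (pair_proj s *m pair_proj t) = (m%:R + #|fixpoints (s^-1 * t)%g|%:R) / 2.
Proof.
rewrite /pair_proj -scalemxAl -scalemxAr scalerA mxtraceZ mulmxA mxtrace_mulC.
rewrite !mulmxA pair_gram -mulmxA pair_gram mulmxDl !mulmxDr !mulmx1 mul1mx -perm_mxM.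
have -> : ((t^-1 * s) * (s^-1 * t) = 1)%g by rewrite mulgA mulgK mulVg.
rewrite perm_mx1 !mxtraceD mxtrace1 tr_perm_mx_fixpoints.
have -> : (t^-1 * s = (s^-1 * t)^-1)%g by rewrite invMg invgK.
rewrite -tr_perm_mx mxtrace_tr tr_perm_mx_fixpoints.
by field.
Qed.

End PairingProjectors.

(** * The lower bound *)

Section Assembly.
Variable R : realType.
Local Notation C := (R[i]).

(** Take a - b = g = 3 eps and let mu = a q + b (1 - q) be the mean level; normalisation forces mu^2
    = 1 - g^2 q (1 - q). Since q (1 - q) >= 2/9, this is at most 1 - eps^2, while a^2 - b^2 = g (a +
    b) with a + b <= 8/3. *)
Lemma two_level_parameters (q eps : R) :
  3^-1 <= q -> q <= 2^-1 -> 0 < eps -> eps <= 6^-1 ->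
  exists a b : R,
    [/\ 0 <= a, 0 <= b, a ^+ 2 * q + b ^+ 2 * (1 - q) = 1,
        (a * q + b * (1 - q)) ^+ 2 <= 1 - eps ^+ 2
      & 0 <= a ^+ 2 - b ^+ 2 <= 8 * eps].
Proof.
move=> q3 q2 eps0 eps6; pose g := 3 * eps.
have g0 : 0 < g by rewrite /g; lra.
have g2 : g <= 2^-1 by rewrite /g; lra.
have gg : g ^+ 2 <= 4^-1 by nra.
have qq : q * (1 - q) <= 4^-1 by nra.
have v0 : 0 <= 1 - g ^+ 2 * (q * (1 - q)) by nra.
pose mu := Num.sqrt (1 - g ^+ 2 * (q * (1 - q))).
have mu2 : mu ^+ 2 = 1 - g ^+ 2 * (q * (1 - q)) by rewrite sqr_sqrtr.
have mu0 : 0 <= mu := sqrtr_ge0 _.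
have mu_half : 2^-1 <= mu by nra.
have mu1 : mu <= 1.
  have : 0 <= g ^+ 2 * (q * (1 - q)) by rewrite mulr_ge0 ?sqr_ge0 ?mulr_ge0 //; lra.
  by move=> h; rewrite -(@ler_pXn2r _ 2) ?nnegrE // expr1n mu2; lra.
exists (mu + g * (1 - q)), (mu - g * q); split.
- by nra.
- by nra.
- transitivity (mu ^+ 2 + g ^+ 2 * (q * (1 - q))); first by ring.
  by rewrite mu2; ring.
- have -> : (mu + g * (1 - q)) * q + (mu - g * q) * (1 - q) = mu by ring.
  rewrite mu2 /g; nra.
- have -> : (mu + g * (1 - q)) ^+ 2 - (mu - g * q) ^+ 2 = g * (2 * mu + g * (1 - 2 * q)).
    by ring.
  have h0 : 0 <= g * (1 - 2 * q) by nra.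
  have h1 : g * (1 - 2 * q) <= 2 / 3 by nra.
  apply/andP; split; first by rewrite mulr_ge0 ?(ltW g0) //; lra.
  have -> : 8 * eps = g * (8 / 3) by rewrite /g; field.
  by rewrite ler_wpM2l ?(ltW g0) //; lra.
Qed.

(* The normalised overlap tr(rho_s rho_t) / d when s^-1 t has f fixed points. *)
Definition overlap (d : nat) (q delta : R) (f : nat) : R :=
  1 + delta ^+ 2 * ((q + f%:R / d%:R) / 2 - q ^+ 2).

(** As q is within 1/(2d) of 1/2, the constant part q/2 - q^2 costs no more than one extra fixed
    point, so the overlap is at most 1 + v (f + 1). Then [average_power_le] with alpha = 1/20 gives
    (1 + alpha)/(1 - alpha) = 21/19. *)
Lemma overlap_average_le (d m N : nat) (q delta eps : R) :
  (0 < d)%N -> 3^-1 <= q -> q <= 2^-1 -> (1 - 2 * q) * d%:R <= 1 ->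
  0 < eps -> 0 <= delta -> delta <= 8 * eps -> N%:R * eps ^+ 2 <= d%:R / 1000 ->
  \sum_(u : 'S_m) overlap d q delta #|fixpoints u| ^+ N <= m`!%:R * (21 / 19).
Proof.
move=> d0 q3 q2 q2' eps0 delta0 delta_le hN.
have dR0 : 0 < d%:R :> R by rewrite ltr0n.
have dn : d%:R != 0 :> R by rewrite gt_eqF.
pose v : R := delta ^+ 2 / (2 * d%:R).
have v0 : 0 <= v by rewrite divr_ge0 ?sqr_ge0 // mulr_ge0 ?ler0n.
have ov_le f : overlap d q delta f <= 1 + v * f.+1%:R.
  rewrite /overlap lerD2l /v -mulrA ler_wpM2l ?sqr_ge0 //.
  rewrite -(ler_pM2r (mulr_gt0 (ltr0n R 2) dR0)).
  have -> : (2 * d%:R)^-1 * f.+1%:R * (2 * d%:R) = f%:R + 1 :> R.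
    by rewrite -natr1; field.
  have -> : ((q + f%:R / d%:R) / 2 - q ^+ 2) * (2 * d%:R) = q * ((1 - 2 * q) * d%:R) + f%:R.
    by field.
  by rewrite addrC lerD2l; nra.
have ov_ge0 f : 0 <= overlap d q delta f.
  have hf : 0 <= f%:R / d%:R :> R by rewrite divr_ge0 ?ler0n.
  have : 0 <= (q + f%:R / d%:R) / 2 - q ^+ 2 by nra.
  by move=> h; rewrite /overlap addr_ge0 // mulr_ge0 ?sqr_ge0.
(* From delta <= 8 eps, N v <= 32 N eps^2 / d <= 32/1000, and 32/1000 times 21/20 is below 1/20. *)
have Nv : N%:R * v * (1 + 20^-1) <= 20^-1.
  have d64 : delta ^+ 2 <= 64 * eps ^+ 2.
    by have -> : 64 * eps ^+ 2 = (8 * eps) ^+ 2 by [ring]; rewrite lerXn2r ?nnegrE // mulr_ge0 // ltW.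
  have hv : N%:R * v <= 32 / 1000.
    rewrite /v mulrA ler_pdivrMr ?mulr_gt0 //.
    apply: (@le_trans _ _ (N%:R * (64 * eps ^+ 2))); first by rewrite ler_wpM2l.
    by rewrite mulrCA; lra.
  by lra.
apply: (@le_trans _ _ (\sum_(u : 'S_m) (1 + v * #|fixpoints u|.+1%:R) ^+ N)).
  apply: ler_sum => u _; rewrite lerXn2r ?nnegrE //.
  by rewrite addr_ge0 // mulr_ge0.
have alpha0 : 0 < 20^-1 :> R by rewrite invr_gt0.
have alpha1 : 20^-1 < 1 :> R by lra.
apply: le_trans (average_power_le m v0 alpha0 alpha1 Nv) _.
by rewrite ler_wpM2l // le_eqVlt; apply/orP; left; apply/eqP; field.
Qed.

(** [max_ent_projector], applied to P and to 1 - P, bounds the overlap with any maximally entangled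
    state by the mean level a q + b (1 - q). *)
Lemma no_inst_two_level d (P : 'M[C]_d) (q a b eps : R) :
  (0 < d)%N -> P *m P = P -> adjmx P = P -> \tr P / d%:R = real_complex R q ->
  0 <= a -> 0 <= b -> 0 <= eps -> a ^+ 2 * q + b ^+ 2 * (1 - q) = 1 ->
  (a * q + b * (1 - q)) ^+ 2 <= 1 - eps ^+ 2 ->
  no_inst (@max_ent R d) eps
    (comb (bvec P) (bvec (1%:M - P)) (real_complex R a) (real_complex R b)).
Proof.
move=> d0 Pi Pa trP a0 b0 eps0 unit_ab far.
have dn : d%:R != 0 :> C by rewrite pnatr_eq0 -lt0n.
have conjR (x : R) : (real_complex R x)^* = real_complex R x.
  by apply/CrealP; rewrite complex_real.
split.
  rewrite /unit_vec (eq_inner (comb_bvec _ _ _) (comb_bvec _ _ _)).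
  rewrite inner_two_level // Pi -[RHS](rmorph1 (real_complex R)) -unit_ab.
  have -> : \tr P = d%:R * real_complex R q by rewrite -trP mulrC divfK.
  rewrite !(rmorphD, rmorphM, rmorphN, rmorphXn, rmorph1) /=.
  by field.
move=> psi mpsi; rewrite /tdist.
have le1 : `|inner psi (comb (bvec P) (bvec (1%:M - P)) (real_complex R a) (real_complex R b))|
    <= real_complex R (a * q + b * (1 - q)).
  have -> : inner psi (comb (bvec P) (bvec (1%:M - P)) (real_complex R a) (real_complex R b)) =
      real_complex R a * inner psi (bvec P) + real_complex R b * inner psi (bvec (1%:M - P)).
    by rewrite !inner_sandwich -sandwich_linr.
  apply: le_trans (ler_normD _ _) _; rewrite !normrM rmorphD !rmorphM.
  have ge0C (x : R) : 0 <= x -> 0 <= real_complex R x.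
    by move=> x0; rewrite -(rmorph0 (real_complex R)) lecR.
  rewrite !(ger0_norm (ge0C _ _)) // lerD // ler_wpM2l ?ge0C //.
    by apply: le_trans (max_ent_projector d0 Pi Pa mpsi) _; rewrite trP.
  apply: le_trans (max_ent_projector d0 (proj_compl_idem Pi) (proj_compl_adj Pa) mpsi) _.
  by rewrite linearB /= mxtrace1 mulrBl divff // trP rmorphB rmorph1.
have ge0eps : 0 <= real_complex R eps by rewrite -(rmorph0 (real_complex R)) lecR.
set w := `| _ | in le1 *.
have w0 : 0 <= w by apply: normr_ge0.
have key : real_complex R eps ^+ 2 <= 1 - w ^+ 2.
  rewrite lerBrDr -lerBrDl; apply: le_trans (_ : real_complex R (a * q + b * (1 - q)) ^+ 2 <= _).
    by rewrite lerXn2r ?nnegrE // (le_trans w0 le1).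
  have -> : 1 - real_complex R eps ^+ 2 = real_complex R (1 - eps ^+ 2).
    by rewrite rmorphB rmorph1 rmorphXn.
  by rewrite -rmorphXn /= lecR.
rewrite -[leLHS](sqrCK ge0eps) ler_sqrtC ?qualifE /= ?exprn_ge0 //.
by apply: le_trans key; apply: exprn_ge0.
Qed.

End Assembly.

Theorem theorem4p10 (R : realType) :
  exists (c eps0 : R), 0 < c /\ 0 < eps0 /\
    forall (d : nat) (eps : R), (2 <= d)%N -> 0 < eps -> eps <= eps0 ->
      forall N : nat, testable_with (@max_ent R d) eps N ->
        c * d%:R / eps ^+ 2 <= N%:R.
Proof.
(* 1/1000 is what [overlap_average_le] needs; eps <= 1/6 keeps the level gap 3 eps at most 1/2. *)
exists (1000^-1), (6^-1); split; first by rewrite invr_gt0.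
split; first by rewrite invr_gt0.
move=> d eps d2 eps0 eps6 N hT; rewrite leNgt; apply/negP => ltN.
have d0 : (0 < d)%N by apply: leq_trans d2.
(* Rounding down allows odd d: d <= 2m + 1 places q = m/d within 1/(2d) of 1/2, and d >= 2 gives q
   >= 1/3. *)
pose m := d./2.
have le_2m_d : (m + m <= d)%N by rewrite /m; lia.
have le_d_2m : (d <= (m + m).+1)%N by rewrite /m; lia.
have le_d_3m : (d <= 3 * m)%N by rewrite /m; lia.
have dR0 : 0 < d%:R :> R by rewrite ltr0n.
have dn : d%:R != 0 :> R by rewrite gt_eqF.
pose q : R := m%:R / d%:R.
have qE : m%:R = q * d%:R :> R by rewrite /q divfK.
have q3 : 3^-1 <= q.
  by move: le_d_3m; rewrite -(ler_nat R) natrM qE => h; rewrite -(ler_pM2r dR0); lra.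
have q2 : q <= 2^-1.
  by move: le_2m_d; rewrite -(ler_nat R) natrD qE => h; rewrite -(ler_pM2r dR0); lra.
have q2' : (1 - 2 * q) * d%:R <= 1.
  by move: le_d_2m; rewrite -(ler_nat R) -natr1 natrD qE; lra.
have [a [b [a0 b0 unit_ab far /andP[delta0 delta_le]]]] := two_level_parameters q3 q2 eps0 eps6.
pose delta : R := a ^+ 2 - b ^+ 2.
pose gram := overlap d q delta.
have dnC : d%:R != 0 :> R[i] by rewrite pnatr_eq0 -lt0n.
have conjR (x : R) : (real_complex R x)^* = real_complex R x.
  by apply/CrealP; rewrite complex_real.
have qC : m%:R / d%:R = real_complex R q by rewrite /q rmorphM fmorphV !rmorph_nat.
have [P [Pi Pa trPd trPP]] : exists P : 'S_m -> 'M[R[i]]_d,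
    [/\ forall s, P s *m P s = P s, forall s, adjmx (P s) = P s,
        forall s, \tr (P s) / d%:R = real_complex R q
      & forall s t, \tr (P s *m P t) = (m%:R + #|fixpoints (s^-1 * t)%g|%:R) / 2].
  exists (@pair_proj R d m); split=> s; first exact: pair_proj_idem.
  - exact: pair_proj_adj.
  - by rewrite tr_pair_proj.
  - by move=> t; apply: tr_pair_projM.
have trP s : \tr (P s) = d%:R * real_complex R q by rewrite -(trPd s) mulrC divfK.
have pow2 (x : R) : real_complex R x ^+ 2 = real_complex R (x ^+ 2) by rewrite rmorphXn.
have rho_rho s t :
    inner (comb (bvec (P s)) (bvec (1%:M - P s)) (real_complex R a ^+ 2) (real_complex R b ^+ 2))
          (comb (bvec (P t)) (bvec (1%:M - P t)) (real_complex R a ^+ 2) (real_complex R b ^+ 2))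
    = real_complex R (gram #|fixpoints (s^-1 * t)%g|).
  rewrite (eq_inner (comb_bvec _ _ _) (comb_bvec _ _ _)) !pow2 inner_two_level //.
  rewrite (trP s) (trP t) trPP.
  set f := #|_|; have -> : m%:R = d%:R * real_complex R q by rewrite -qC mulrC divfK.
  have b2 : b ^+ 2 = 1 - delta * q by rewrite -unit_ab /delta; ring.
  have -> : a ^+ 2 = delta + b ^+ 2 by rewrite /delta; ring.
  rewrite b2 /gram /overlap !(rmorphD, rmorphM, rmorphN, rmorphXn, rmorph1, fmorphV, rmorph_nat) /=.
  by field.
have tl1 s : two_level (P s) 1 1 = 1%:M by rewrite /two_level subrr scale0r addr0.
have rho_phi s :
    inner (comb (bvec (P s)) (bvec (1%:M - P s)) (real_complex R a ^+ 2) (real_complex R b ^+ 2))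
      (bvec 1%:M) = 1.
  rewrite (eq_inner (comb_bvec _ _ _) (frefl _)) -(tl1 s) !pow2 inner_two_level //.
  rewrite trP -[RHS](rmorph1 (real_complex R)) -unit_ab.
  rewrite !(rmorphD, rmorphM, rmorphN, rmorphXn, rmorph1) /=.
  by field.
have phi_rho s :
    inner (bvec 1%:M)
      (comb (bvec (P s)) (bvec (1%:M - P s)) (real_complex R a ^+ 2) (real_complex R b ^+ 2)) = 1.
  rewrite (eq_inner (frefl _) (comb_bvec _ _ _)) -(tl1 s) !pow2 inner_two_level ?rmorph1 //.
  rewrite trP -[RHS](rmorph1 (real_complex R)) -unit_ab.
  rewrite !(rmorphD, rmorphM, rmorphN, rmorphXn, rmorph1) /=.
  by field.
have cardS : #|{: 'S_m}| = m`! by rewrite card_Sn.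
have S0 : (0 < #|{: 'S_m}|)%N by rewrite cardS fact_gt0.
have phi_unit : inner (bvec (1%:M : 'M[R[i]]_d)) (bvec 1%:M) = 1 by have [] := max_ent_bvec1 R d0.
have W_comb s z x y :
    apply_op (rmul_op (two_level (P s) z 1)) (comb (bvec (P s)) (bvec (1%:M - P s)) x y)
      =1 comb (bvec (P s)) (bvec (1%:M - P s)) (x * z) y.
  move=> i; rewrite (eq_apply (fun _ _ => erefl) (comb_bvec _ _ _)) apply_rmul_bvec.
  by rewrite two_level_mul // mulr1 comb_bvec.
(* For every s the two components sum to the vector of the identity, so one yes-instance serves all
   the hard instances. *)
have bound := @chi_square_bound R (bip d) 'S_m (@max_ent R d) eps N (bvec 1%:M)
  (fun s => bvec (P s)) (fun s => bvec (1%:M - P s)) (real_complex R a) (real_complex R b)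
  (fun s z => rmul_op (two_level (P s) z 1)) S0 (conjR a) (conjR b) phi_unit
  (max_ent_bvec1 R d0)
  (fun s x => etrans (comb_bvec (P s) 1 1 x) (congr1 (fun A => bvec A x) (tl1 s)))
  (fun s => no_inst_two_level d0 (Pi s) (Pa s)
     (trPd s) a0 b0 (ltW eps0) unit_ab far)
  (fun s z z1 => symmetry_rmul eps (two_level_unitary (Pi s) (Pa s) z1))
  W_comb rho_phi phi_rho hT.
(* Substituting t = s u makes the inner sum independent of s. *)
have reindex : \sum_(s : 'S_m) \sum_(t : 'S_m) real_complex R (gram #|fixpoints (s^-1 * t)%g|) ^+ N =
    real_complex R (m`!%:R * \sum_(u : 'S_m) gram #|fixpoints u| ^+ N).
  rewrite rmorphM rmorph_nat rmorph_sum -cardS mulr_natl -sumr_const.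
  apply: eq_big => // s _; rewrite (reindex_inj (mulgI s)) /=.
  by apply: eq_bigr => u _; rewrite mulKg rmorphXn.
move: bound; under eq_bigr do under eq_bigr do rewrite rho_rho.
rewrite reindex cardS.
have F0 : m`!%:R != 0 :> R by rewrite pnatr_eq0 -lt0n fact_gt0.
have -> : 4 / 27 = real_complex R (4 / 27) by rewrite rmorphM fmorphV !rmorph_nat.
have -> : m`!%:R ^- 2 = real_complex R (m`!%:R ^- 2) by rewrite fmorphV rmorphXn rmorph_nat.
have sub1 (z : R) : real_complex R z - 1 = real_complex R (z - 1).
  by rewrite rmorphB rmorph1.
rewrite -rmorphM sub1 lecR leNgt => /negP; apply.
have hN : N%:R * eps ^+ 2 <= d%:R / 1000.
  by move: ltN; rewrite ltr_pdivlMr ?exprn_gt0 // => /ltW; rewrite [_^-1 * _]mulrC.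
have avg := overlap_average_le m d0 q3 q2 q2' eps0 delta0 delta_le hN.
have F2 : 0 < m`!%:R :> R by rewrite ltr0n fact_gt0.
(* The second moment is at most 21/19 - 1 = 2/19, below the required 4/27. *)
have : m`!%:R ^- 2 * (m`!%:R * \sum_(u : 'S_m) gram #|fixpoints u| ^+ N) <= 21 / 19 :> R.
  have -> : m`!%:R ^- 2 * (m`!%:R * \sum_(u : 'S_m) gram #|fixpoints u| ^+ N)
      = (\sum_(u : 'S_m) gram #|fixpoints u| ^+ N) / m`!%:R by field.
  by rewrite ler_pdivrMr // mulrC.
by lra.
Qed.
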